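(* Let $T$ be a connected $\mathbb{Z}^d$-tile, with associated matrix $A$ and digit set $\mathcal{D}$. Then one of the following alternatives holds: (1) $T$ has a cut point. (2) Each irreducible cut set $X$ of $T$ admits a partition $X=X'\cup X_1$ with $X_1$ contained in $$\widetilde{E}:=\bigcup_{k\in\mathbb{N}}\ \bigcup_{\substack{v,s\in\mathbb{Z}^d\\ \#(T\cap(T+s))=1}}\Bigl(A^{-k}\bigl(T\cap(T+s)\bigr)+A^{-k}v\Bigr).$$
   Context: A $\mathbb{Z}^d$-tile (integral self-affine $\mathbb{Z}^d$-tile with standard digit set) $T=T(A,\mathcal{D})\subset\mathbb{R}^d$ is given by a $d\times d$ integer matrix $A$ all of whose eigenvalues are greater than $1$ in modulus and a complete set $\mathcal{D}\subset\mathbb{Z}^d$ of coset representatives of $\mathbb{Z}^d/A\mathbb{Z}^d$ (so $|\mathcal{D}|=|\det A|$); $T$ is the unique nonempty compact set with $AT=T+\mathcal{D}=\bigcup_{e\in\mathcal{D}}(T+e)$, i.e. the attractor of the IFS $\{f_e\}_{e\in\mathcal{D}}$, $f_e(x)=A^{-1}(x+e)$. It is assumed that $T$ has nonempty interior and that $T+\mathbb{Z}^d$ is a tiling of $\mathbb{R}^d$: $\mathbb{R}^d=T+\mathbb{Z}^d$ and $\mathrm{int}(T+d_1)\cap(T+d_2)=\emptyset$ for all $d_1\ne d_2$ in $\mathbb{Z}^d$. $\mathbb{N}=\{1,2,3,\ldots\}$. A cut set of a connected set $Y$ is a subset $X\subset Y$ such that $Y\setminus X$ is disconnected; a cut point of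 $Y$ is a point $x\in Y$ such that $\{x\}$ is a cut set of $Y$. A cut set $X$ of a connected set $Y$ is irreducible if $Y\setminus X_0$ is connected for every proper subset $X_0$ of $X$ which is closed in $Y$. $X'$ is the derived set (set of limit points) of $X$. A partition is a decomposition into disjoint (possibly empty) sets. ''One of the alternatives holds'' is understood inclusively. *)

(* Defs.v *)
From HB Require Import structures.
From mathcomp Require Import all_boot all_order all_algebra.
From mathcomp Require Import all_classical all_reals all_analysis.
From mathcomp.real_closed Require Import complex.
Set Implicit Arguments.
Unset Strict Implicit.
Unset Printing Implicit Defensive.
Import Order.TTheory GRing.Theory Num.Theory.
Import numFieldNormedType.Exports.
Local Open Scope classical_set_scope.
Local Open Scope ring_scope.

Section CutSets.
Context {S : topologicalType}.
Implicit Types X Y : set S.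

(* [connected set0] holds, so a cut set of Y never exhausts Y. *)
Definition cut_set Y X := X `<=` Y /\ ~ connected (Y `\` X).

Definition cut_point Y (x : S) := Y x /\ cut_set Y [set x].

Definition closed_in Y X := exists2 F, closed F & X = F `&` Y.

(* X itself is not required to be closed. *)
Definition irreducible_cut_set Y X :=
  cut_set Y X /\
  forall X0, X0 `<` X -> closed_in Y X0 -> connected (Y `\` X0).

End CutSets.

Section Tiles.
Context {R : realType} {d : nat}.
Implicit Types (A : 'M[int]_d) (D : set 'cV[int]_d) (T : set 'cV[R]_d).

Definition toR {m n} (M : 'M[int]_(m, n)) : 'M[R]_(m, n) := map_mx intr M.

Definition expanding A :=
  forall z : R[i], eigenvalue (map_mx intr A : 'M[R[i]]_d) z -> 1 < `|z|.

(* Every coset of Z^d / A Z^d meets D in exactly one point; for expanding A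
   this forces D to be finite with |det A| elements. *)
Definition complete_residues A D :=
  forall z : 'cV[int]_d, exists! e, D e /\ exists y, z = e + A *m y.

Definition translate T (v : 'cV[int]_d) : set 'cV[R]_d :=
  [set x + toR v | x in T].

(* Together with expansion, [tile_self_affine] characterizes T among nonempty compact
   sets, the maps x |-> A^-1 (x + e) being contractions for a suitable norm. *)
Record Zd_tile A D T : Prop := {
  tile_expanding : expanding A;
  tile_digits : complete_residues A D;
  tile_nonempty : T !=set0;
  tile_compact : compact T;
  tile_self_affine :
    [set toR A *m x | x in T] = \bigcup_(e in D) translate T e;
  tile_interior : T° !=set0;
  tile_cover : \bigcup_v translate T v = setT;
  tile_disjoint : forall v w, v <> w ->
    (translate T v)° `&` translate T w = set0
}.

Definition Etilde A T : set 'cV[R]_d :=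
  \bigcup_(k in [set k | (0 < k)%N]) \bigcup_v
    \bigcup_(s in [set s | (T `&` translate T s #= `I_1)%card])
      [set invmx (toR A) ^+ k *m x + invmx (toR A) ^+ k *m toR v
        | x in T `&` translate T s].

End Tiles.

(* Main.v *)
(* An irreducible cut set X of T is the complement in T of two disjoint open sets
   G and G', because T is metrizable; hence X is closed.  If x is isolated in X then
   T minus (X minus x) is connected, so x is a cluster point of both T meet G and
   T meet G'.  The finitely many pieces A^-k (T + v) that tile T are arbitrarily
   small, so for large k those through x meet X at most in x.  When T has no cut
   point, each such piece minus x is connected, hence lies on one side.  A piece on
   the side of G and a piece on the side of G' meet only in x, and such
   a one-point intersection lies in Etilde. *)

Require Import Defs.
From mathcomp Require Import all_boot all_order all_algebra.
From mathcomp Require Import all_classical all_reals all_analysis.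
From mathcomp.real_closed Require Import complex.
From mathcomp Require Import ring zify.
Import Order.TTheory GRing.Theory Num.Theory.
Import numFieldNormedType.Exports.
Local Open Scope classical_set_scope.
Local Open Scope ring_scope.

(** * Matrix norms and geometric decay of matrix powers *)

Lemma ler_mx_entry_norm {K : numDomainType} {m n : nat} (M : 'M[K]_(m, n)) i j :
  `|M i j| <= `|M|.
Proof.
rewrite [leRHS]/Num.norm /= mx_normE -[leLHS]nngE num_le.
exact: (le_bigmax _ _ (i, j)).
Qed.

(** The constants live in the scalar field itself, so the notion serves over both the complex and
    the real numbers. *)
Definition geometrically_small (K : numFieldType) (V : normedModType K)
    (u : nat -> V) :=
  exists c r : K, [/\ 0 <= c, 0 <= r, r < 1 & forall k, `|u k| <= c * r ^+ k].

Arguments geometrically_small {K V} u.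

(** A first-order linear recurrence with contracting factor [a] and geometrically small forcing; the
    bound follows by induction on [k]. *)
Lemma geometrically_small_peel (K : numFieldType) (V : normedModType K)
    (u : nat -> V) (a : K) :
  `|a| < 1 -> geometrically_small (fun k => u k.+1 - a *: u k) ->
  geometrically_small u.
Proof.
move=> a1 [c [r [c0 r0 r1 ur]]].
pose m := Num.max r `|a|.
have cmp : r >=< `|a| by rewrite real_comparable // ger0_real.
have rm : r <= m by rewrite comparable_le_max // lexx.
have am : `|a| <= m by rewrite comparable_le_max // lexx orbT.
have m1 : m < 1 by rewrite comparable_gt_max // r1.
(* A ratio strictly above both r and |a| avoids resonance when they agree. *)
pose s := (m + 1) / 2.
have ms : m < s by rewrite /s midf_lt.
have s1 : s < 1 by rewrite /s midf_lt.
have s0 : 0 <= s by rewrite (le_trans r0)// (le_trans rm) ?ltW.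
have as0 : 0 < s - `|a| by rewrite subr_gt0 (le_lt_trans am).
(* The first summand gives the base case; the second gives [c <= c' * (s - |a|)], which closes the
   induction step. *)
pose c' := `|u 0| + c / (s - `|a|).
have c'0 : 0 <= c' by rewrite addr_ge0 // divr_ge0 // ltW.
exists c', s; split=> //; elim=> [|k IH].
  by rewrite expr0 mulr1 lerDl divr_ge0 // ltW.
have cc' : c <= c' * (s - `|a|).
  by rewrite mulrDl divfK ?gt_eqF // lerDr mulr_ge0 // ltW.
rewrite -[u k.+1](subrK (a *: u k)) (le_trans (ler_normD _ _)) // normrZ.
have -> : c' * s ^+ k.+1 = c' * (s - `|a|) * s ^+ k + `|a| * (c' * s ^+ k).
  by rewrite exprS; ring.
apply: lerD; last exact: ler_wpM2l.
rewrite (le_trans (ur k)) // ler_pM ?exprn_ge0 // lerXn2r ?nnegrE //.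
by rewrite (le_trans rm) ?ltW.
Qed.

(* By Cayley-Hamilton the product of all M - a over the eigenvalues a is 0;
   its factors are peeled off one at a time, each being u k.+1 - a *: u k. *)
Lemma mx_pow_geometrically_small (K : numClosedFieldType) (n : nat) (M : 'M[K]_n) :
  (forall a, eigenvalue M a -> `|a| < 1) ->
  geometrically_small (fun k => M ^+ k).
Proof.
case: n M => [M _|n M evM].
  exists 0, 0; split=> // k.
  by rewrite [M ^+ k]flatmx0 normr0 mul0r.
have [rs chE] := closed_field_poly_normal (char_poly M).
move: chE; rewrite (monicP (char_poly_monic M)) scale1r => chE.
have rs1 : {in rs, forall a, `|a| < 1}.
  by move=> a ars; apply: evM; rewrite eigenvalue_root_char chE root_prod_XsubC.
suff small (s : seq K) : {in s, forall a, `|a| < 1} ->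
    geometrically_small (fun k => (\prod_(a <- s) (M - a%:M)) * M ^+ k) ->
    geometrically_small (fun k => M ^+ k).
  apply: (small rs rs1); exists 0, 0; split=> // k.
  have -> : \prod_(a <- rs) (M - a%:M) = 0 :> 'M[K]_n.+1.
    rewrite -(Cayley_Hamilton M) chE rmorph_prod /=.
    by apply: eq_bigr => a _; rewrite rmorphB /= horner_mx_X horner_mx_C.
  by rewrite mul0r normr0 mul0r.
elim/last_ind: s => [|s a IH] sa.
  by under eq_fun => k do rewrite big_nil mul1r.
move=> small; apply: IH => [b bs|]; first by rewrite sa // mem_rcons in_cons bs orbT.
apply: (@geometrically_small_peel _ _ _ a); first by rewrite sa // mem_rcons mem_head.
move: small; congr (geometrically_small _); apply/funext => k.
rewrite big_rcons /= mulrBr mulrBl exprS mulrA; congr (_ - _).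
by rewrite -scalemx1 -!scalerAr mulr1 -scalerAl.
Qed.

Lemma ler_norm_mx (K : realDomainType) (m n : nat) (M : 'M[K]_(m, n)) (e : K) :
  0 <= e -> (forall i j, `|M i j| <= e) -> `|M| <= e.
Proof.
move=> e0 Me; rewrite [leLHS]/Num.norm /= mx_normrE.
by apply/bigmax_leP; split=> // -[i j] _; exact: Me.
Qed.

Lemma ler_norm_mulmx {K : realDomainType} {m n p : nat}
    (M : 'M[K]_(m, n)) (N : 'M[K]_(n, p)) : `|M *m N| <= n%:R * `|M| * `|N|.
Proof.
apply: ler_norm_mx => [|i j]; first by rewrite !mulr_ge0.
rewrite mxE (le_trans (ler_norm_sum _ _ _)) //.
rewrite -[n in n%:R]card_ord -mulrA mulr_natl -sumr_const ler_sum // => k _.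
by rewrite normrM ler_pM // ler_mx_entry_norm.
Qed.

Lemma mulmx_continuous (K : realType) (m n p : nat) (M : 'M[K]_(m, n)) :
  continuous (fun N : 'M[K]_(n, p) => M *m N).
Proof.
apply: (@bounded_linear_continuous K 'M[K]_(n, p) 'M[K]_(m, p) (mulmx M)).
apply/linear_boundedP; exists (n%:R * `|M|); split=> [|r Mr N].
  by rewrite num_real.
by rewrite (le_trans (ler_norm_mulmx _ _)) // ler_wpM2r // ltW.
Qed.

(** * Inverse powers of an expanding matrix *)

Section Expanding.
Context {R : realType} {d : nat} (A : 'M[int]_d).
Hypothesis expA : expanding (R := R) A.

Let toC : map_mx (real_complex R) (toR A) = map_mx intr A.
Proof. by apply/matrixP => i j; rewrite !mxE rmorph_int. Qed.

Lemma expanding_unitmx : (toR A : 'M[R]_d) \in unitmx.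
Proof.
rewrite -(map_unitmx (real_complex R)) toC -row_free_unit -kermx_eq0.
apply: contraT => kerA0.
have : eigenvalue (map_mx intr A : 'M[R[i]]_d) 0.
  by rewrite /eigenvalue /eigenspace raddf0 subr0.
by move=> /expA; rewrite normr0 ltr10.
Qed.

(** Eigenvalues of the inverse are inverses of eigenvalues of [A], so the decay holds over the
    complex numbers; it descends because the embedding of the reals preserves absolute values of
    entries. *)
Lemma expanding_inv_pow_small :
  geometrically_small (fun k => invmx (toR A) ^+ k : 'M[R]_d).
Proof.
pose B : 'M[R]_d := invmx (toR A).
pose BC := map_mx (real_complex R) B.
have AC_unit : map_mx intr A \in @unitmx R[i] d.
  by rewrite -toC map_unitmx expanding_unitmx.
have BCE : BC = invmx (map_mx intr A) by rewrite /BC map_invmx toC.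
have [a|c [r [c0 r0 r1 small]]] := @mx_pow_geometrically_small R[i] d BC.
  rewrite BCE => /eigenvalueP[v vBa v0].
  have a0 : a != 0.
    apply: contraNneq v0 => a0.
    by rewrite -[v](mulmxKV AC_unit) vBa a0 scale0r mul0mx.
  have : eigenvalue (map_mx intr A : 'M[R[i]]_d) a^-1.
    apply/eigenvalueP; exists v => //.
    by rewrite -[in RHS](mulmxKV AC_unit v) vBa scalemxAl scalerA mulVf // scale1r.
  by move=> /expA; rewrite normfV invf_gt1 // normr_gt0.
(* Being nonnegative, the complex constants [c] and [r] are real. *)
have [c' cE] : exists c', c = c'%:C%C by exists (complex.Re c); rewrite RRe_real ?ger0_real.
have [r' rE] : exists r', r = r'%:C%C by exists (complex.Re r); rewrite RRe_real ?ger0_real.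
move: c0 r0 r1; rewrite cE rE !ler0c (ltcR _ 1) => c0 r0 r1.
exists c', r'; split=> // k; apply: ler_norm_mx => [|i j].
  by rewrite mulr_ge0 ?exprn_ge0.
rewrite -lecR rmorphM rmorphXn /= -cE -rE.
apply: le_trans (small k); apply: le_trans (ler_mx_entry_norm _ i j).
by rewrite /BC -rmorphXn /= mxE normc_def /= expr0n addr0 sqrtr_sqr.
Qed.

End Expanding.

(** * Irreducible cut sets in pseudometric spaces *)

Lemma closure_setI_open {S : topologicalType} (U V : set S) :
  open V -> U `&` V = set0 -> closure U `&` V = set0.
Proof.
move=> openV UV0; apply/seteqP; split=> // y [cUy Vy].
have [z] := cUy _ (open_nbhs_nbhs (conj openV Vy)).
by rewrite UV0.
Qed.

Section IrreducibleCutSets.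
Context {R : realType} {S : pseudoMetricType R}.
Implicit Types (X Y U V : set S) (x : S).

(** Each point of one set has a ball missing the other set; the balls of half the radius form the
    two neighbourhoods. *)
Lemma separated_open_disjoint U V : separated U V ->
  exists P Q, [/\ open P, open Q, P `&` Q = set0, U `<=` P & V `<=` Q].
Proof.
pose halo U V := \bigcup_(ue in [set ue : S * R |
  [/\ U ue.1, 0 < ue.2 & ball ue.1 ue.2 `&` V = set0]])
    (ball ue.1 (ue.2 / 2))°.
have halo_open U' V' : open (halo U' V').
  by apply: bigcup_open => ue _; exact: open_interior.
have sub_halo U' V' : U' `&` closure V' = set0 -> U' `<=` halo U' V'.
  move=> UV0 u Uu; have : ~ closure V' u by move=> cu; rewrite -[False]/(set0 u) -UV0.
  move=> /existsNP[W /not_implyP[/nbhs_ballP[e /= e0 eW] /nonemptyPn VW]].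
  exists (u, e) => /=; first split=> //.
    by apply/seteqP; split=> // y [/eW Wy Vy]; rewrite -VW.
  by apply: nbhsx_ballx; rewrite divr_gt0.
move=> [UV VU]; exists (halo U V), (halo V U); split=> //.
- apply/seteqP; split=> // y [[[u e] /= [Uu e0 uV]]] /interior_subset ye.
  move=> [[v f] /= [Vv f0 vU]] /interior_subset yf.
  (* If two half-radius balls meet, their centres are closer than the larger radius, so the ball of
     that radius meets the other set. *)
  clear UV VU; wlog fe : u v e f U V Uu Vv e0 f0 uV vU ye yf / f <= e => [H|].
    have [fe|/ltW ef] := leP f e; first exact: (H u v e f U V).
    exact: (H v u f e V U).
  suff : (ball u e `&` V) v by rewrite uV.
  split=> //.
  apply: le_ball (ball_triangle ye (ball_sym yf)).
  by rewrite [leRHS]splitr lerD2l ler_pM2r // invr_gt0.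
- exact: sub_halo.
- by apply: sub_halo; rewrite setIC.
Qed.

(* Shrinking X to the complement of two disjoint open sets still cuts Y, so by
   irreducibility X is that complement: irreducible cut sets are relatively closed. *)
Lemma irreducible_cut_set_open Y X : irreducible_cut_set Y X ->
  exists O : bool -> set S, [/\ forall b, open (O b), O false `&` O true = set0,
    forall b, Y `&` O b !=set0 & X = Y `\` (O false `|` O true)].
Proof.
move=> [[XY /connectedPn[E [E0 YXE sepE]]] irr].
have [P [Q [openP openQ PQ0 EP EQ]]] := separated_open_disjoint _ _ sepE.
pose O b := if b then Q else P.
have sX : Y `\` (P `|` Q) `<=` X.
  move=> y [Yy nO]; apply: contrapT => nX; apply: nO.
  have : (Y `\` X) y by [].
  by rewrite YXE => -[/EP|/EQ]; [left|right].
have sub b : E b `<=` Y.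
  move=> y Ey; suff : (Y `\` X) y by case.
  by rewrite YXE; case: b Ey; [right|left].
have YO0 b : Y `&` O b !=set0.
  have [y Ey] := E0 b; exists y; split; first exact: sub Ey.
  by case: b Ey; [exact: EQ|exact: EP].
exists O; split=> //; first by case.
have [//|XnO] := pselect (X = Y `\` (P `|` Q)); exfalso.
have : connected (Y `\` (Y `\` (P `|` Q))).
  apply: irr; first by rewrite properEneq; split=> //; apply/eqP => /esym.
  by exists (~` (P `|` Q)); [exact/open_closedC/openU|rewrite setIC].
rewrite setDD => /connectedP/(_ (fun b => Y `&` O b)).
apply; split=> //; first by rewrite setIUr.
split.
  by rewrite (setIC Y Q) setIA closure_setI_open ?set0I // -setIA PQ0 setI0.
rewrite setIC (setIC Y P) setIA closure_setI_open ?set0I //.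
by rewrite -setIA (setIC Q) PQ0 setI0.
Qed.

(** Putting [x] back must reconnect the space. Were [x] away from the closure of side [b], it could
    join the other side and the separation would persist. *)
Lemma irreducible_cut_set_isolated Y X (O : bool -> set S) b x :
  irreducible_cut_set Y X -> (forall c, open (O c)) -> O false `&` O true = set0 ->
  (forall c, Y `&` O c !=set0) -> X = Y `\` (O false `|` O true) ->
  X x -> ~ limit_point X x -> closure (Y `&` O b) x.
Proof.
move=> [[XY nconn] irr] oO O0 YO XE Xx; rewrite not_limit_pointE => -[W Wx XW].
have [Yx nOx] : (Y `\` (O false `|` O true)) x by rewrite -XE.
apply: contrapT => nclx.
have : connected (Y `\` (X `\` [set x])).
  apply: irr.
    rewrite properEneq; split; last exact: subDsetl.
    by apply/eqP => XE'; move: Xx; rewrite -{1}XE' => -[_]; apply.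
  (* The neighbourhood [W] meets [X] only in [x], so deleting its interior removes just [x] and
     keeps the set closed. *)
  exists (~` (O false `|` O true `|` W°)).
    by apply: open_closedC; apply: openU; [exact: openU|exact: open_interior].
  apply/seteqP; split=> [y [Xy yx]|y [nO Yy]].
    split; last exact: XY.
    move=> [Oy|/interior_subset Wy]; last by apply: yx; exact: XW.
    by move: Xy; rewrite XE => -[].
  split; first by rewrite XE; split=> // Oy; apply: nO; left.
  by move=> yx; apply: nO; right; rewrite yx.
have nOb c : ~ O c x by move=> Ocx; apply: nOx; case: c Ocx; [right|left].
have Ob0 c : O c `&` O (~~ c) = set0 by case: c => //=; rewrite setIC.
move=> /connectedP/(_ (fun c => if c then x |` (Y `&` O (~~ b)) else Y `&` O b)).
apply; split.
- by case=> //; exists x; left.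
- apply/seteqP; split=> [y [Yy nXy]|y].
    have [->|/eqP yx] := eqVneq y x; first by right; left.
    have [Oy|nOy] := pselect ((O false `|` O true) y); last first.
      by case: nXy; split=> //; rewrite XE.
    by case: (b) Oy => -[] Oy; [right; right|left|left|right; right].
  move=> Ey; split.
    by case: Ey => [[]//|[->|[]]//].
  move=> [+ yx]; rewrite XE => -[_]; apply.
  case: Ey => [[_]|[//|[_]]]; case: (b) => /= ?; by [left|right].
- split; last first.
    rewrite setIC (setIC Y (O b)) setIA closure_setI_open ?set0I // setIUl.
    rewrite -setIA (setIC (O (~~ b))) Ob0 setI0 setU0.
    by apply/seteqP; split=> // y [->] /nOb.
  have clb0 : closure (Y `&` O b) `&` O (~~ b) = set0.
    by apply: closure_setI_open => //; rewrite -setIA Ob0 setI0.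
  rewrite setIUr (setIC Y (O (~~ b))) setIA clb0 set0I setU0.
  by apply/seteqP; split=> // y [+ yx]; rewrite yx.
Qed.

End IrreducibleCutSets.

(** * Subdivision of the tile into small pieces *)

Lemma finite_int_vectors (R : realType) (d : nat) (b : R) :
  finite_set [set v : 'cV[int]_d | `|toR v : 'cV[R]_d| <= b].
Proof.
pose N := Num.truncn b.
(* Entries between [-N] and [N] are encoded as ordinals shifted by [N]. *)
pose f (g : {ffun 'I_d -> 'I_(N + N).+1}) : 'cV[int]_d :=
  \col_i ((g i)%:Z - N%:Z).
apply: (@sub_finite_set _ _ (f @` setT)); last exact/finite_image/finite_finset.
move=> v /= vb.
have vN i : (`|v i 0%R| <= N)%N.
  rewrite truncn_ge_nat ?(le_trans _ vb) //.
  by rewrite (le_trans _ (ler_mx_entry_norm (toR v) i 0)) // mxE natr_absz intr_norm.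
exists [ffun i => inord `|(v i 0 + N%:Z)%R|%N] => //.
apply/colP => i; rewrite !mxE ffunE inordK; last by have := vN i; lia.
by have := vN i; lia.
Qed.

(** The set A^-k (T + v) for an arbitrary integer vector [v]; the subtiles of [T] are singled out
    later by inclusion in [T], not by digit expansions. *)
Definition piece {R : realType} {d : nat} (A : 'M[int]_d) (T : set 'cV[R]_d)
    k (v : 'cV[int]_d) : set 'cV[R]_d :=
  [set invmx (toR A) ^+ k *m (t + toR v) | t in T].

Section Pieces.
Context {R : realType} {d : nat} {A : 'M[int]_d} {D : set 'cV[int]_d}
  {T : set 'cV[R]_d}.
Hypothesis tileT : Zd_tile A D T.

Let B : 'M[R]_d := invmx (toR A).
Local Notation piece := (piece A T).

Let A_unit : (toR A : 'M[R]_d) \in unitmx.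
Proof. exact/expanding_unitmx/(tile_expanding tileT). Qed.

Let BK : cancel (mulmx B) (mulmx (toR A) : 'cV[R]_d -> 'cV[R]_d).
Proof. exact: (mulKVmx A_unit). Qed.

Let BexprK k : cancel (mulmx (B ^+ k)) (mulmx (toR A ^+ k) : 'cV[R]_d -> 'cV[R]_d).
Proof.
elim: k => [|k IH] x; first by rewrite !expr0 !mul1mx.
by rewrite (exprS B) (exprSr (toR A)) -!mulmxE -!mulmxA BK IH.
Qed.

(** Induction on [k]: the equation AT = T + D splits the piece of index [v] into those of index
    [e + A *m v] one level deeper. *)
Lemma piece_cover k y : T y -> exists2 v, piece k v `<=` T & piece k v y.
Proof.
move=> Ty; elim: k => [|k [v vT [t Tt <-]]].
  exists 0 => [_ [t Tt <-]|]; first by rewrite expr0 mul1mx /toR map_mx0 addr0.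
  by exists y => //; rewrite expr0 mul1mx /toR map_mx0 addr0.
have : [set toR A *m x | x in T] (toR A *m t) by exists t.
rewrite (tile_self_affine tileT) => -[e De [u Tu uE]].
have tE q : B ^+ k.+1 *m (q + toR (e + A *m v)) =
            B ^+ k *m (B *m (q + toR e) + toR v).
  rewrite exprSr -mulmxE -mulmxA; congr (_ *m _).
  rewrite /toR map_mxD map_mxM /= addrA mulmxDr; congr (_ + _).
  by rewrite mulKmx.
have BAK (q : 'cV[R]_d) : B *m (toR A *m q) = q by exact: mulKmx.
exists (e + A *m v).
  move=> _ [q Tq <-]; rewrite tE; apply: vT.
  have : (\bigcup_(e in D) translate T e) (q + toR e) by exists e => //; exists q.
  rewrite -(tile_self_affine tileT) => -[p Tp pE].
  by exists p => //; rewrite -pE BAK.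
by exists u => //; rewrite tE uE BAK.
Qed.

(** For a fixed point [t0] of [T], such an index has the form A^k y - t0 with [y] in [T], hence is
    bounded. *)
Lemma finite_piece_index k : finite_set [set v | piece k v `<=` T].
Proof.
have [t0 Tt0] := tile_nonempty tileT.
have [b [_ Tb]] := compact_bounded (tile_compact tileT).
have {}Tb t : T t -> `|t| <= `|b| + 1.
  by move=> Tt; apply: Tb => //; rewrite (le_lt_trans (ler_norm b)) ?ltrDl.
pose c := d%:R * `|toR A ^+ k : 'M[R]_d| * (`|b| + 1) + (`|b| + 1).
apply: sub_finite_set (finite_int_vectors _ d c) => v vT /=.
have : T (B ^+ k *m (t0 + toR v)) by apply: vT; exists t0.
set y := (X in T X) => Ty.
have -> : toR v = toR A ^+ k *m y - t0 by rewrite BexprK addrC addKr.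
rewrite (le_trans (ler_normB _ _)) // lerD ?Tb //.
rewrite (le_trans (ler_norm_mulmx _ _)) //.
by rewrite ler_wpM2l ?mulr_ge0 ?Tb.
Qed.

Let affine_continuous k v : continuous (fun t : 'cV[R]_d => B ^+ k *m (t + toR v)).
Proof.
under eq_fun do rewrite mulmxDr.
move=> t.
have cB := @mulmx_continuous R d d 1 (B ^+ k) t.
pose cst_v : 'cV[R]_d -> 'cV[R]_d := fun=> B ^+ k *m toR v.
have := @continuousD R 'cV[R]_d 'cV[R]_d (mulmx (B ^+ k)) cst_v t cB.
by apply; exact: (@cst_continuous 'cV[R]_d).
Qed.

Lemma piece_closed k v : closed (piece k v).
Proof.
apply: compact_closed; first exact: norm_hausdorff.
apply: continuous_compact (tile_compact tileT).
exact/continuous_subspaceT/affine_continuous.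
Qed.

Lemma piece_small (e : R) : 0 < e ->
  exists2 k, (0 < k)%N & forall v x y, piece k v x -> piece k v y -> `|x - y| < e.
Proof.
move=> e0.
have [b [_ Tb]] := compact_bounded (tile_compact tileT).
have {}Tb t : T t -> `|t| <= `|b| + 1.
  by move=> Tt; apply: Tb => //; rewrite (le_lt_trans (ler_norm b)) ?ltrDl.
have [c [r [c0 r0 r1 small]]] := expanding_inv_pow_small A (tile_expanding tileT).
pose a := d%:R * c * (`|b| + 1 + (`|b| + 1)).
have : geometric a r @ \oo --> 0 by apply: cvg_geometric; rewrite ger0_norm.
move=> /cvgrPdist_lt /(_ _ e0) [N _ Ne].
(* The successor makes the level positive, as [Etilde] requires. *)
exists N.+1 => // v _ _ [t Tt <-] [u Tu <-].
rewrite -mulmxBr opprD addrACA subrr addr0.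
apply: le_lt_trans (Ne N.+1 _) => //=.
rewrite sub0r normrN (le_trans (ler_norm_mulmx _ _)) // (le_trans _ (ler_norm _)) //.
have -> : a * r ^+ N.+1 = d%:R * (c * r ^+ N.+1) * (`|b| + 1 + (`|b| + 1)).
  by rewrite /a; ring.
rewrite ler_pM ?mulr_ge0 ?ler_wpM2l //.
by rewrite (le_trans (ler_normB _ _)) // lerD ?Tb.
Qed.

(** An injective affine map carries [T] minus a point onto the punctured piece. *)
Lemma piece_setD1_connected k v x : connected T ->
  (forall y, ~ cut_point T y) -> piece k v x -> connected (piece k v `\` [set x]).
Proof.
move=> connT nocut [t Tt <-].
have -> : piece k v `\` [set B ^+ k *m (t + toR v)] =
    [set B ^+ k *m (u + toR v) | u in T `\` [set t]].
  apply/seteqP; split=> [_ [[u Tu <-] ut]|_ [u [Tu ut] <-]].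
    by exists u => //; split=> // utE; apply: ut; rewrite utE.
  split; first by exists u.
  by move=> /(can_inj (BexprK k)) /addIr /ut.
apply: connected_continuous_connected; last first.
  exact/continuous_subspaceT/affine_continuous.
apply: contrapT => nconn; apply: (nocut t); split=> //; split=> //.
by move=> _ ->.
Qed.

(** Applying A^k and translating by [-v] turns the intersection into that of [T] and its translate
    by [w - v], which is the witness [s]. *)
Lemma piece_meet_Etilde k v w x : (0 < k)%N ->
  piece k v `&` piece k w = [set x] -> Etilde A T x.
Proof.
move=> k0 vw.
have [[t Tt tx] [u Tu ux]] : (piece k v `&` piece k w) x by rewrite vw.
have tuE : t = u + toR (w - v).
  have := congr1 (mulmx (toR A ^+ k)) (etrans tx (esym ux)).
  by rewrite !BexprK /toR map_mxB addrA => <-; rewrite addrK.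
have meetE : T `&` translate T (w - v) = [set t].
  apply/seteqP; split=> [q [Tq [p Tp pq]]|_ ->]; last by split=> //; exists u.
  have : (piece k v `&` piece k w) (B ^+ k *m (q + toR v)).
    split; first by exists q.
    by exists p => //; rewrite -pq /toR map_mxB addrA subrK.
  by rewrite vw -tx => /(can_inj (BexprK k)) /addIr.
exists k => //; exists v => //; exists (w - v) => /=; last first.
  by exists t; [split=> //; exists u|rewrite -mulmxDr].
by rewrite meetE; exact/card_set1.
Qed.

(** The finitely many subtiles missing [x] have a closed union, so some point of [U] avoids it; any
    subtile covering that point contains [x]. *)
Lemma cluster_piece k U x : U `<=` T -> closure U x ->
  exists v, [/\ piece k v `<=` T, piece k v x & piece k v `&` U !=set0].
Proof.
move=> UT clUx.
pose far := [set v | piece k v `<=` T] `&` [set v | ~ piece k v x].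
have : closed (\bigcup_(v in far) piece k v).
  apply: closed_bigcup => [|v _]; last exact: piece_closed.
  exact/finite_setIl/finite_piece_index.
move=> /closed_openC open_near.
have [|y [Uy nfar]] := clUx (~` \bigcup_(v in far) piece k v).
  by apply: open_nbhs_nbhs; split=> // -[v [_ nvx] vx].
have [v vT vy] := piece_cover k _ (UT _ Uy).
exists v; split=> //; last by exists y.
by apply: contrapT => nvx; apply: nfar; exists v.
Qed.

End Pieces.

(** * Isolated points of an irreducible cut set of the tile *)

Theorem theorem3p1 (R : realType) (d : nat) (A : 'M[int]_d)
    (D : set 'cV[int]_d) (T : set 'cV[R]_d) :
  Zd_tile A D T -> connected T ->
  (exists x : 'cV[R]_d, cut_point T x) \/
  (forall X : set 'cV[R]_d, irreducible_cut_set T X ->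
    exists X1 : set 'cV[R]_d,
      [/\ X = limit_point X `|` X1,
          limit_point X `&` X1 = set0 &
          X1 `<=` Etilde A T]).
Proof.
move=> tileT connT.
have [cut|nocut] := pselect (exists x, cut_point T x); [by left|right=> X irrX].
have [G [G_open G0 TG XE]] := irreducible_cut_set_open _ _ irrX.
(* The isolated points of [X]; this yields a partition because [X] is closed. *)
exists (X `\` limit_point X).
have limX : limit_point X `<=` X.
  have clT : closed T by apply: compact_closed (tile_compact tileT); exact: norm_hausdorff.
  have clX : closed X.
    rewrite XE setDE; apply: closedI => //; exact/open_closedC/openU.
  by move=> x /subset_limit_point; exact: clX.
split; [by rewrite setDUK|by rewrite setDIK|].
move=> x [Xx x_isolated].
have [W Wx XW] : exists2 W, nbhs x W & X `&` W `<=` [set x].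
  by rewrite -not_limit_pointE.
have /nbhs_ballP[e /= e0 eW] := Wx.
(* At this level a piece through [x] stays in the [e]-ball, where [X] has no other point. *)
have [k k0 small] := piece_small tileT e e0.
have side b : exists v, [/\ piece A T k v x & piece A T k v `\` [set x] `<=` G b].
  have clx := irreducible_cut_set_isolated _ _ _ b _ irrX G_open G0 TG XE Xx x_isolated.
  have [v [vT vx [y [vy [_ Gy]]]]] := cluster_piece tileT k _ x (@subIsetl _ _ _) clx.
  exists v; split=> //.
  have nGx c : ~ G c x.
    by move=> Gcx; move: Xx; rewrite XE => -[_]; apply; case: c Gcx; [right|left].
  have sub : piece A T k v `\` [set x] `<=` G false `|` G true.
    move=> q [vq qx]; apply: contrapT => nGq; apply: qx; apply: XW.
    split; first by rewrite XE; split=> //; exact: vT.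
    by apply: eW; rewrite -ball_normE /=; exact: small vx vq.
  have sepG : separated (G false) (G true).
    by split; [|rewrite setIC]; apply: closure_setI_open => //; rewrite setIC.
  have nocut' z : ~ cut_point T z by move=> cz; apply: nocut; exists z.
  have conn := piece_setD1_connected tileT k v x connT nocut' vx.
  have vxy : (piece A T k v `\` [set x]) y.
    by split=> // yx; apply: (nGx b); rewrite -yx.
  (* The punctured piece lies on a single side, and its point [y] in [G b] decides which. *)
  have [] := connected_subset sepG sub conn; case: b Gy {clx} => // Gy /(_ _ vxy) Gy'.
    by suff : (G false `&` G true) y by rewrite G0.
  by suff : (G false `&` G true) y by rewrite G0.
have [[v [vx vG]] [w [wx wG]]] := (side false, side true).
apply: (piece_meet_Etilde tileT k v w) => //.
apply/seteqP; split=> [y [vy wy]|_ -> //].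
apply: contrapT => yx.
suff : (G false `&` G true) y by rewrite G0.
by split; [exact: vG|exact: wG].
Qed.
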